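(* Let $\mathcal G$ be an undirected, connected, unweighted $d$-regular network on $N_{\rm a}$ nodes with adjacency matrix $A_{\rm a}$, and let $\mathcal G'$, the effective communication network with adjacency matrix $A_{\rm a}'$, $[A_{\rm a}']_{ik}=(\hat{\mathbf p}_i^T\hat{\mathbf p}_k)[A_{\rm a}]_{ik}$, be a connected network in which only one node, node $1$, has a heterogeneous projection constraint with respect to all other nodes; that is, all agents $j\in\{2,\dots,N_{\rm a}\}$ have the same unit constraint vector $\hat{\mathbf p}_2$, and agent $1$ has unit constraint vector $\hat{\mathbf p}_1$. The approximate (first-order) eigenvector centrality of $\mathcal G'$ is $$\mathbf v_{\max}'\approx \mathbf 1_{N_{\rm a}}+\big(1-\hat{\mathbf p}_1^T\hat{\mathbf p}_2\big)\,B\,\big(-d^2+d,\;M^T\big)^T,$$ where $B=\frac{1}{2N_{\rm a}}\mathbf 1_{N_{\rm a}}\mathbf 1_{N_{\rm a}}^T+\big((A_{\rm a}-dI)^2\big)^{\dagger}$, $M=(m_{12},\dots,m_{1N_{\rm a}})^T\in\mathbb{R}^{N_{\rm a}-1}$, $m_{1j}=\sum_{k=1}^{N_{\rm a}}[A_{\rm a}]_{1k}[A_{\rm a}]_{kj}$ is the number of mutual neighbors of agents $1$ and $j$, and $(\cdot)^\dagger$ is the Moore–Penrose pseudo-inverse.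
   Context: $\hat{\mathbf p}_i=\mathbf p_i/\|\mathbf p_i\|$ is the unit vector along agent $i$'s nonzero constraint vector $\mathbf p_i\in\mathbb{R}^{N_{\rm o}}$. $A_{\rm a}$ is symmetric with entries in $\{0,1\}$, zero diagonal and all row sums equal to $d$. $\mathbf 1_n$ is the all-ones vector in $\mathbb{R}^n$. Meaning of $\approx$: put $\delta=\hat{\mathbf p}_1^T\hat{\mathbf p}_2-1$. Then $A_{\rm a}'=A_{\rm a}'(\delta)$ is obtained from $A_{\rm a}$ by multiplying the weights of the $d$ edges incident to node $1$ by $1+\delta$, and $A_{\rm a}'(0)=A_{\rm a}$. Let $\mathbf v_{\max}'(\delta)$ be the eigenvector of the dominant (largest, simple for $\delta$ near $0$) eigenvalue of $A_{\rm a}'(\delta)$, depending smoothly on $\delta$, with $\mathbf v_{\max}'(0)=\mathbf 1_{N_{\rm a}}$ and constant Euclidean norm $\|\mathbf v_{\max}'(\delta)\|^2=N_{\rm a}$. The symbol $\approx$ denotes the first-order approximation $\mathbf v_{\max}'(\delta)\approx\mathbf v_{\max}'(0)+\delta\,\frac{d\mathbf v_{\max}'}{d\delta}(0)$; the assertion is that this first-order approximation equals the right-hand side displayed in the claim. *)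

(* Defs.v *)
From HB Require Import structures.
From mathcomp Require Import all_boot all_order all_algebra.
From mathcomp Require Import all_classical all_reals all_analysis.

Set Implicit Arguments.
Unset Strict Implicit.
Unset Printing Implicit Defensive.

Import Order.TTheory GRing.Theory Num.Theory.
Import numFieldNormedType.Exports.

Local Open Scope classical_set_scope.
Local Open Scope ring_scope.

Definition dot (R : realType) (n : nat) (u v : 'cV[R]_n) : R := (u^T *m v) 0 0.

(* The library norm on matrices is the max norm, hence this Euclidean one. *)
Definition enorm (R : realType) (n : nat) (u : 'cV[R]_n) : R :=
  Num.sqrt (dot u u).

Definition unit_vector (R : realType) (n : nat) (u : 'cV[R]_n) : 'cV[R]_n :=
  (enorm u)^-1 *: u.

Definition ones (R : realType) (n : nat) : 'cV[R]_n := const_mx 1.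

(* Nodes are numbered from 0: node k of the mathematics is the ordinal k - 1. *)
Definition regular_adjacency (R : realType) (n d : nat) (A : 'M[R]_n) : Prop :=
  [/\ A^T = A,
      forall i j, A i j = 0 \/ A i j = 1,
      forall i, A i i = 0
    & forall i, \sum_j A i j = d%:R].

Definition connected_network (R : realType) (n : nat) (A : 'M[R]_n) : Prop :=
  forall i j : 'I_n, connect [rel x y | A x y != 0] i j.

Definition effective_adjacency (R : realType) (n No : nat)
    (p : 'I_n -> 'cV[R]_No) (A : 'M[R]_n) : 'M[R]_n :=
  \matrix_(i, k) (dot (unit_vector (p i)) (unit_vector (p k)) * A i k).

(* A'(delta): the weights of the edges incident to the first node are
   multiplied by 1 + delta. *)
Definition perturbed_adjacency (R : realType) (n : nat) (A : 'M[R]_n.+1)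
    (delta : R) : 'M[R]_n.+1 :=
  \matrix_(i, k) (if (i == ord0) || (k == ord0) then (1 + delta) * A i k
                  else A i k).

Definition largest_eigenvalue (R : realType) (n : nat) (A : 'M[R]_n) (l : R)
    : Prop :=
  eigenvalue A l /\ forall mu, eigenvalue A mu -> mu <= l.

(* [eigenvalue] concerns row vectors; it is only used here for symmetric
   matrices.  Differentiability of all the derivatives is asked on one common
   neighbourhood of 0, i.e. [v] is C^oo there.  Simplicity of the largest
   eigenvalue is not required: it follows from connectedness. *)
Definition dominant_eigenvector_branch (R : realType) (n : nat)
    (A' : R -> 'M[R]_n.+1) (v : R -> 'cV[R]_n.+1) : Prop :=
  [/\ \forall delta \near (0 : R), forall k : nat, derivable (derive1n k v) delta 1,
      \forall delta \near (0 : R), exists2 l : R,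
        largest_eigenvalue (A' delta) l & A' delta *m v delta = l *: v delta,
      \forall delta \near (0 : R), enorm (v delta) ^+ 2 = n.+1%:R
    & v 0 = ones R n.+1].

Definition first_order_approx (R : realType) (n : nat)
    (v : R -> 'cV[R]_n.+1) (delta : R) : 'cV[R]_n.+1 :=
  v 0 + delta *: derive1 v 0.

Definition moore_penrose (R : realType) (m n : nat) (A : 'M[R]_(m, n))
    (X : 'M[R]_(n, m)) : Prop :=
  [/\ A *m X *m A = A, X *m A *m X = X,
      (A *m X)^T = A *m X & (X *m A)^T = X *m A].

(* Well defined by [moore_penrose_exists] and [moore_penrose_unique]. *)
Definition pinv (R : realType) (m n : nat) (A : 'M[R]_(m, n)) : 'M[R]_(n, m) :=
  xget 0 [set X | moore_penrose A X].

Definition mutual_neighbors (R : realType) (n : nat) (A : 'M[R]_n)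
    (i j : 'I_n) : R :=
  \sum_k A i k * A k j.

(* The vector M = (m_12, ..., m_1N). *)
Definition mutual_vector (R : realType) (n : nat) (A : 'M[R]_n.+1)
    : 'cV[R]_n :=
  \col_j mutual_neighbors A ord0 (lift ord0 j).

Definition correction_matrix (R : realType) (n d : nat) (A : 'M[R]_n.+1)
    : 'M[R]_n.+1 :=
  (2 * n.+1%:R)^-1 *: (ones R n.+1 *m (ones R n.+1)^T)
  + pinv ((A - d%:R%:M) ^+ 2).

(* The vector (- d^2 + d, M^T)^T. *)
Definition correction_vector (R : realType) (n d : nat) (A : 'M[R]_n.+1)
    : 'cV[R]_n.+1 :=
  col_mx ((- d%:R ^+ 2 + d%:R)%:M : 'cV[R]_1) (mutual_vector A).

Section Facts.
Variable R : realType.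

Lemma dotE n (u v : 'cV[R]_n) : dot u v = \sum_i u i 0 * v i 0.
Proof. by rewrite /dot mxE; apply: eq_bigr => i _; rewrite mxE. Qed.

Lemma dot_ge0 n (u : 'cV[R]_n) : 0 <= dot u u.
Proof. by rewrite dotE sumr_ge0 // => i _; rewrite -expr2 sqr_ge0. Qed.

Lemma dot_eq0 n (u : 'cV[R]_n) : dot u u = 0 -> u = 0.
Proof.
rewrite dotE => /eqP; rewrite psumr_eq0; last first.
  by move=> i _; rewrite -expr2 sqr_ge0.
move=> /allP u0; apply/matrixP => i j; rewrite (ord1 j) mxE.
by have := u0 i (mem_index_enum i); rewrite /= mulf_eq0 orbb => /eqP.
Qed.

Lemma dot_unit_vector n (u : 'cV[R]_n) : u != 0 ->
  dot (unit_vector u) (unit_vector u) = 1.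
Proof.
move=> u0; have d0 : dot u u != 0 by apply: contra_neq u0 => /dot_eq0.
have -> : dot (unit_vector u) (unit_vector u) = (enorm u ^+ 2)^-1 * dot u u.
  rewrite !dotE mulr_sumr; apply: eq_bigr => i _.
  by rewrite !mxE mulrACA -expr2 exprVn.
by rewrite /enorm sqr_sqrtr ?dot_ge0// mulVf.
Qed.

Lemma dotC n (u v : 'cV[R]_n) : dot u v = dot v u.
Proof. by rewrite !dotE; apply: eq_bigr => i _; rewrite mulrC. Qed.

(* With a single heterogeneous node, the effective adjacency matrix is the
   member of the perturbed family at delta = p1 . p2 - 1. *)
Lemma effective_adjacencyE n No (p : 'I_n.+2 -> 'cV[R]_No) (A : 'M[R]_n.+2) :
  let p1 := unit_vector (p ord0) in
  let p2 := unit_vector (p (lift ord0 ord0)) in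
  (forall i, p i != 0) -> (forall i, A i i = 0) ->
  (forall j, j != ord0 -> unit_vector (p j) = p2) ->
  effective_adjacency p A = perturbed_adjacency A (dot p1 p2 - 1).
Proof.
move=> p1 p2 p0 A0 pj; apply/matrixP => i k; rewrite !mxE addrC subrK.
case: (eqVneq i ord0) => [->|i0] /=; case: (eqVneq k ord0) => [->|k0] /=.
- by rewrite A0 !mulr0.
- by rewrite (pj _ k0).
- by rewrite (pj _ i0) dotC.
- by rewrite (pj _ i0) (pj _ k0) dot_unit_vector ?p0// mul1r.
Qed.

Lemma gram_unit m n (C : 'M[R]_(m, n)) : row_free C^T -> C^T *m C \in unitmx.
Proof.
move=> freeC; rewrite -row_free_unit; apply/inj_row_free => u uC.
apply/(row_free_inj freeC); rewrite mul0mx.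
rewrite -[u *m C^T]trmxK (_ : (u *m C^T)^T = 0) ?trmx0//; apply: dot_eq0.
by rewrite /dot trmxK trmx_mul trmxK -mulmxA (mulmxA C^T) mulmxA uC
   mul0mx mxE.
Qed.

Lemma moore_penrose_exists m n (A : 'M[R]_(m, n)) :
  exists X, moore_penrose A X.
Proof.
have [r [C [B [EA uC uB]]]] : exists r (C : 'M[R]_(m, r)) (B : 'M[R]_(r, n)),
    [/\ A = C *m B, C^T *m C \in unitmx & B *m B^T \in unitmx].
  exists (\rank A), (col_base A), (row_base A); split.
  - by rewrite mulmx_base.
  - by apply: gram_unit; rewrite /row_free mxrank_tr; exact: col_base_full.
  - have := @gram_unit _ _ (row_base A)^T; rewrite trmxK; apply.
    exact: row_base_free.
pose G := invmx (C^T *m C); pose H := invmx (B *m B^T).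
have GT : G^T = G by rewrite /G trmx_inv trmx_mul trmxK.
have HT : H^T = H by rewrite /H trmx_inv trmx_mul trmxK.
have AX : A *m (B^T *m H *m (G *m C^T)) = C *m G *m C^T.
  by rewrite EA !mulmxA -(mulmxA C B) -(mulmxA C) mulmxV ?mulmx1.
have XA : B^T *m H *m (G *m C^T) *m A = B^T *m H *m B.
  by rewrite EA !mulmxA -(mulmxA _ C^T) -(mulmxA _ G) mulVmx ?mulmx1.
exists (B^T *m H *m (G *m C^T)); split.
- by rewrite AX EA !mulmxA -(mulmxA _ C^T) -(mulmxA _ G) mulVmx ?mulmx1.
- by rewrite XA !mulmxA -(mulmxA _ B) -(mulmxA _ _ H) mulmxV ?mulmx1.
- by rewrite AX !trmx_mul trmxK GT mulmxA.
- by rewrite XA !trmx_mul trmxK HT mulmxA.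
Qed.

Lemma moore_penrose_unique m n (A : 'M[R]_(m, n)) X Y :
  moore_penrose A X -> moore_penrose A Y -> X = Y.
Proof.
move=> [AXA XAX AXT XAT] [AYA YAY AYT YAT].
have eA : A *m X = A *m Y.
  rewrite -AXT -[in LHS]AYA -(mulmxA (A *m Y)) trmx_mul AXT AYT.
  by rewrite mulmxA AXA.
have eB : X *m A = Y *m A.
  rewrite -XAT -[in LHS]AYA (mulmxA X) (mulmxA X) -(mulmxA (X *m A)).
  by rewrite trmx_mul XAT YAT -!mulmxA (mulmxA A) AXA.
by rewrite -XAX -mulmxA eA mulmxA eB YAY.
Qed.

Lemma pinvP m n (A : 'M[R]_(m, n)) : moore_penrose A (pinv A).
Proof.
have [X AX] := moore_penrose_exists A.
by rewrite /pinv; apply: (xgetPex 0 (P := moore_penrose A)); exists X.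
Qed.

End Facts.

(* Main.v *)
Require Import Defs.
From HB Require Import structures.
From mathcomp Require Import all_boot all_order all_algebra.
From mathcomp Require Import all_classical all_reals all_analysis.
From mathcomp Require Import ring lra.

Set Implicit Arguments.
Unset Strict Implicit.
Unset Printing Implicit Defensive.

Import Order.TTheory GRing.Theory Num.Theory.
Import numFieldNormedType.Exports.

Local Open Scope classical_set_scope.
Local Open Scope ring_scope.

(** Write [L = A - dI] and [A'(delta) = A + delta E], where [E] is the star of
edges at the first node.  The eigenvector equation, differentiated at
[delta = 0] where the eigenvector is the all-ones vector [1], says that
[L v' + E 1] is a multiple of [1] ([eigenvector_branch_derivative]).  By
regularity [L 1 = 0], so applying [L] removes the unknown derivative of the
eigenvalue: [L^2 v' = - L E 1].  A direct computation identifies [L E 1] with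
the vector [c = (-d^2 + d, M)] ([laplacian_star]): both are
[(A^2 - d^2 I) e], [e] being the first basis vector.

It remains to invert [L^2].  On a connected graph the kernel of [L], hence of
the symmetric matrix [L^2], is spanned by [1]
([connected_laplacian_kernel]), and the constant norm makes [v'] orthogonal
to [1] ([normalized_branch_derivative]).  The pseudo-inverse of [L^2]
therefore recovers [v'] from [L^2 v' = - c] ([pinv_mulK]).  Finally
[1^T c = 1^T L E 1 = 0], so the rank-one summand of the correction matrix
contributes nothing, and [v' = - B c]. *)

(** * Derivatives of matrix-valued functions *)

Lemma is_derive_entry (R : realType) m n (M : R -> 'M[R]_(m, n)) (t : R) i j :
  derivable M t 1 -> is_derive t 1 (fun x => M x i j) (derive1 M t i j).
Proof.
move=> dM; rewrite derive1E (derive_mx dM) mxE; apply: derivableP.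
exact: (derivable_mxP _ _ _).1.
Qed.

Lemma is_derive_mulmx_entry (R : realType) m n q
    (F : R -> 'M[R]_(m, n)) (G : R -> 'M[R]_(n, q))
    (F' : 'M[R]_(m, n)) (G' : 'M[R]_(n, q)) (t : R) i j :
  (forall i k, is_derive t 1 (fun x => F x i k) (F' i k)) ->
  (forall k j, is_derive t 1 (fun x => G x k j) (G' k j)) ->
  is_derive t 1 (fun x => (F x *m G x) i j) ((F' *m G t + F t *m G') i j).
Proof.
move=> dF dG.
have -> : (fun x => (F x *m G x) i j) =
    \sum_(k < n) ((fun x => F x i k) * (fun x => G x k j)).
  by apply/funext => x; rewrite fct_sumE mxE; apply: eq_bigr.
apply: is_derive_eq; rewrite !mxE -big_split /=; apply: eq_bigr => k _.
by rewrite /GRing.scale /=; ring.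
Qed.

(** * First-order perturbation of the dominant eigenvector *)

(** Nothing is assumed on the regularity of the eigenvalue [l]: two vectors
[w] and [v] with [w = l v] satisfy [w_i v_j = w_j v_i], an identity between
differentiable functions in which [l] does not occur.  Its derivative at [0]
says that the coordinates of [E 1 + A v' - d v'] are all equal. *)
Lemma eigenvector_branch_derivative (R : realType) n (A E : 'M[R]_n)
    (v : R -> 'cV[R]_n) (d : R) :
  A *m ones R n = d *: ones R n -> v 0 = ones R n -> derivable v 0 1 ->
  (\forall t \near (0 : R), exists l : R, (A + t *: E) *m v t = l *: v t) ->
  exists k : R,
    (A - d%:M) *m derive1 v 0 = k *: ones R n - E *m ones R n.
Proof.
case: n A E v => [|n] A E v A1 v0 dv vP.
  by exists 0; apply/matrixP => -[].
pose v' := derive1 v 0; pose F t := A + t *: E.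
have dv' i (j : 'I_1) : is_derive (0 : R) 1 (fun t => v t i j) (v' i j).
  exact: is_derive_entry.
have dF i k : is_derive (0 : R) 1 (fun t => F t i k) (E i k).
  have -> : (fun t => F t i k) = cst (A i k) + (E i k \*: (id : R -> R)).
    by apply/funext => t; rewrite /F !mxE mulrC.
  by apply: is_derive_eq; rewrite add0r /GRing.scale /= mulr1.
pose w t := F t *m v t.
have dw i : is_derive (0 : R) 1 (fun t => w t i 0)
    ((E *m ones R n.+1 + A *m v') i 0).
  have := is_derive_mulmx_entry i 0 dF dv'.
  by rewrite v0 /F scale0r addr0.
have w0 : w 0 = d *: ones R n.+1 by rewrite /w /F scale0r addr0 v0.
have cross i j : (E *m ones R n.+1 + A *m v' - d *: v') i 0 =
                 (E *m ones R n.+1 + A *m v' - d *: v') j 0.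
  (* [f i j] and [f j i] agree near [0], hence have the same derivative. *)
  pose f a b : R -> R := (fun t => w t a 0) * (fun t => v t b 0).
  have df a b : is_derive (0 : R) 1 (f a b)
      (d * v' b 0 + (E *m ones R n.+1 + A *m v') a 0).
    by apply: is_derive_eq; rewrite w0 v0 !mxE /GRing.scale /=; ring.
  have fE : \forall t \near (0 : R), f i j t = f j i t.
    near=> t; have [l lP] : exists l : R, w t = l *: v t by near: t.
    by rewrite /f /= !fctE lP !mxE; ring.
  have /(@derive_val _ _ _ _ _ _ _) := near_eq_is_derive fE (df i j).
  rewrite (@derive_val _ _ _ _ _ _ _ (df j i)) !mxE => h.
  lra.
move: (_ 0 0) (cross^~ 0) => k crossk; exists k.
apply/matrixP => i j; rewrite (ord1 j) mulmxBl mul_scalar_mx.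
by have := crossk i; rewrite !mxE => <-; ring.
Unshelve. all: by end_near. Qed.

(** The derivative of [v^T v] at [0] is [2 v(0)^T v'(0)]. *)
Lemma normalized_branch_derivative (R : realType) n
    (v : R -> 'cV[R]_n) (c : R) :
  v 0 = ones R n -> derivable v 0 1 ->
  (\forall t \near (0 : R), enorm (v t) ^+ 2 = c) ->
  dot (ones R n) (derive1 v 0) = 0.
Proof.
move=> v0 dv vP; pose v' := derive1 v 0.
have dv' i (j : 'I_1) : is_derive (0 : R) 1 (fun t => v t i j) (v' i j).
  exact: is_derive_entry.
have dvT (j : 'I_1) i : is_derive (0 : R) 1 (fun t => (v t)^T j i) (v'^T j i).
  rewrite mxE (_ : (fun t => _) = (fun t => v t i j)) //.
  by apply/funext => t; rewrite mxE.
have dN := is_derive_mulmx_entry 0 0 dvT dv'.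
have NE : \forall t \near (0 : R), ((v t)^T *m v t) 0 0 = cst c t.
  near=> t; have : enorm (v t) ^+ 2 = c by near: t.
  by rewrite /enorm sqr_sqrtr ?dot_ge0.
have := near_eq_is_derive NE dN.
move=> /(@derive_val _ _ _ _ _ _ _); rewrite derive_cst v0 mxE.
rewrite -/(dot _ _) -/(dot _ _) dotC -mulr2n => /esym /eqP.
by rewrite mulrn_eq0 /= => /eqP.
Unshelve. all: by end_near. Qed.

(** * The kernel of the graph Laplacian *)

(** The Dirichlet energy.  Expanding the square, each of the terms in [w_i^2]
and [w_j^2] sums to [d w^T w] because the rows and, by symmetry, the columns
of [A] sum to [d]. *)
Lemma laplacian_form (R : realType) n (A : 'M[R]_n) (d : R) (w : 'cV[R]_n) :
  A^T = A -> (forall i, \sum_j A i j = d) ->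
  \sum_i \sum_j A i j * (w i 0 - w j 0) ^+ 2
    = - (dot w ((A - d%:M) *m w)) *+ 2.
Proof.
move=> AT Ad.
have quad : dot w (A *m w) = \sum_i \sum_j A i j * (w i 0 * w j 0).
  rewrite dotE; apply: eq_bigr => i _; rewrite mxE mulr_sumr.
  by apply: eq_bigr => j _; ring.
have sq : d * dot w w = \sum_i \sum_j A i j * w i 0 ^+ 2.
  rewrite dotE mulr_sumr; apply: eq_bigr => i _.
  by rewrite -mulr_suml Ad expr2.
have sq' : d * dot w w = \sum_i \sum_j A i j * w j 0 ^+ 2.
  rewrite sq exchange_big; apply: eq_bigr => i _; apply: eq_bigr => j _.
  by rewrite -[in LHS]AT mxE.
have -> : dot w ((A - d%:M) *m w) = dot w (A *m w) - d * dot w w.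
  by rewrite mulmxBl mul_scalar_mx /dot mulmxBr -scalemxAr !mxE.
transitivity (d * dot w w - dot w (A *m w) *+ 2 + d * dot w w); last by ring.
rewrite {1}sq sq' quad -sumrMnl -sumrB -big_split; apply: eq_bigr => i _ /=.
rewrite -sumrMnl -sumrB -big_split; apply: eq_bigr => j _ /=; ring.
Qed.

(** A vector in the kernel has zero Dirichlet energy, so it takes equal values
at adjacent nodes, hence along every path. *)
Lemma connected_laplacian_kernel (R : realType) n d (A : 'M[R]_n.+1)
    (w : 'cV[R]_n.+1) :
  regular_adjacency d A -> connected_network A ->
  (A - d%:R%:M) *m w = 0 -> w = w 0 0 *: ones R n.+1.
Proof.
move=> [AT A01 _ Ad] conA Lw.
have A_ge0 i j : 0 <= A i j by case: (A01 i j) => ->.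
have term_ge0 i j : 0 <= A i j * (w i 0 - w j 0) ^+ 2.
  by rewrite mulr_ge0 ?sqr_ge0.
have /eqP := laplacian_form w AT Ad.
rewrite Lw /dot mulmx0 mxE oppr0 mul0rn psumr_eq0 => [|i _]; last first.
  by apply: sumr_ge0.
move=> /allP sum0.
have edge i j : A i j != 0 -> w i 0 = w j 0.
  move=> Aij; have := sum0 i (mem_index_enum i); rewrite /= psumr_eq0 //.
  move=> /allP /(_ j (mem_index_enum j)) /=.
  by rewrite mulf_eq0 (negPf Aij) sqrf_eq0 subr_eq0 => /eqP.
apply/matrixP => i j; rewrite (ord1 j) !mxE mulr1.
have /connectP[s] := conA 0 i.
elim: s (0 : 'I_n.+1) => [|y s IHs] x /=; first by move=> _ ->.
by move=> /andP[/edge -> ys] /(IHs _ ys).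
Qed.

(** [P = S^+ S] is a symmetric matrix with [S P = S] and [P 1 = 0].  Thus
[P w - w] lies in the kernel of [S], which is the line of [1], and is
orthogonal to [1]; so it vanishes. *)
Lemma pinv_mulK (R : realType) n (S : 'M[R]_n) (w : 'cV[R]_n) :
  S *m ones R n = 0 ->
  (forall u : 'cV[R]_n, S *m u = 0 -> exists k : R, u = k *: ones R n) ->
  dot (ones R n) w = 0 -> Defs.pinv S *m (S *m w) = w.
Proof.
move=> S1 kerS w1; have [SXS _ _ PT] := Defs.pinvP S.
set P := Defs.pinv S *m S in PT.
have P1 : (ones R n)^T *m P = 0.
  by rewrite -PT -trmx_mul /P -mulmxA S1 mulmx0 trmx0.
have u1 : dot (ones R n) (P *m w - w) = 0.
  by rewrite /dot mulmxBr mulmxA P1 mul0mx sub0r mxE -/(dot _ _) w1 oppr0.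
have [k uE] : exists k : R, P *m w - w = k *: ones R n.
  by apply: kerS; rewrite mulmxBr /P !mulmxA SXS subrr.
rewrite mulmxA -/P; apply/eqP; rewrite -subr_eq0; apply/eqP/dot_eq0.
by rewrite [X in dot X _]uE /dot linearZ /= -scalemxAl mxE -/(dot _ _) u1 mulr0.
Qed.

(** * The perturbation and the correction vector *)

(** The derivative in [delta] of the perturbed adjacency matrix: the weights
of the edges incident to the first node. *)
Definition star (R : realType) n (A : 'M[R]_n.+1) : 'M[R]_n.+1 :=
  \matrix_(i, k) (if (i == ord0) || (k == ord0) then A i k else 0).

Lemma perturbed_adjacency_star (R : realType) n (A : 'M[R]_n.+1) (t : R) :
  perturbed_adjacency A t = A + t *: star A.
Proof. by apply/matrixP => i k; rewrite !mxE; case: ifP => _; ring. Qed.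

Lemma star_ones (R : realType) n d (A : 'M[R]_n.+1) :
  regular_adjacency d A ->
  star A *m ones R n.+1 = d%:R *: delta_mx ord0 0 + A *m delta_mx ord0 0.
Proof.
move=> [_ _ A0 Ad]; rewrite -colE; apply/matrixP => i j.
rewrite (ord1 j) !mxE eqxx andbT; under eq_bigr do rewrite !mxE mulr1.
case: (eqVneq i ord0) => [->|i0] /=.
  by rewrite A0 addr0 mulr1; exact: Ad.
rewrite mulr0 add0r (bigD1 ord0) //= big1 ?addr0 // => k.
by move=> /negPf ->.
Qed.

Lemma correction_vectorE (R : realType) n d (A : 'M[R]_n.+1) :
  regular_adjacency d A ->
  correction_vector d A = (A *m A - (d%:R ^+ 2)%:M) *m delta_mx ord0 0.
Proof.
move=> [AT A01 A0 Ad]; rewrite -colE; apply/matrixP => i j.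
have AC k l : A k l = A l k by rewrite -[in LHS]AT mxE.
rewrite (ord1 j) [RHS]mxE [RHS]mxE /correction_vector.
case: (split_ordP (i : 'I_(1 + n))) => k -> {i}.
  rewrite (@col_mxEu R 1 n 1) (ord1 k) !mxE.
  rewrite (_ : lshift n 0 = ord0) ?eqxx; last exact: val_inj.
  rewrite mulr1n addrC; congr (_ + _).
  (* The entries of [A] are idempotent, so a node has [d] walks of length two
     back to itself. *)
  rewrite -(Ad ord0); apply: eq_bigr => l _.
  by rewrite (AC l); case: (A01 ord0 l) => ->; rewrite ?mulr0 ?mulr1.
rewrite (@col_mxEd R 1 n 1).
have -> : rshift 1 k = lift ord0 k by apply: val_inj.
rewrite mxE /mutual_neighbors !mxE mulr0n subr0.
by apply: eq_bigr => l _; rewrite mulrC (AC l) (AC ord0).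
Qed.

(** With [e] the first basis vector, [(A - d)(d e + A e) = (A^2 - d^2) e]. *)
Lemma laplacian_star (R : realType) n d (A : 'M[R]_n.+1) :
  regular_adjacency d A ->
  (A - d%:R%:M) *m (star A *m ones R n.+1) = correction_vector d A.
Proof.
move=> rA; rewrite (star_ones rA) (correction_vectorE rA).
rewrite -mul_scalar_mx -mulmxDl mulmxA; congr (_ *m _).
rewrite mulmxBl !mulmxDr -scalar_mxM scalar_mxC -expr2.
by rewrite opprD [X in X + _]addrC addrACA subrr addr0.
Qed.

Lemma laplacian_ones (R : realType) n d (A : 'M[R]_n) :
  regular_adjacency d A -> A *m ones R n = d%:R *: ones R n.
Proof.
move=> [_ _ _ Ad]; apply/matrixP => i j; rewrite !mxE mulr1 -(Ad i).
by apply: eq_bigr => k _; rewrite mxE mulr1.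
Qed.

(** * The first-order eigenvector centrality *)

Theorem mainTheorem7 (R : realType) (n d No : nat)
    (A : 'M[R]_n.+2)
    (p : 'I_n.+2 -> 'cV[R]_No)
    (v : R -> 'cV[R]_n.+2) :
  let p1 := unit_vector (p ord0) in
  let p2 := unit_vector (p (lift ord0 ord0)) in
  regular_adjacency d A ->
  connected_network A ->
  (forall i, p i != 0) ->
  (forall j, j != ord0 -> unit_vector (p j) = p2) ->
  connected_network (effective_adjacency p A) ->
  dominant_eigenvector_branch (perturbed_adjacency A) v ->
  first_order_approx v (dot p1 p2 - 1)
    = ones R n.+2
      + (1 - dot p1 p2) *: (correction_matrix d A *m correction_vector d A).
Proof.
move=> p1 p2 rA conA _ _ _ [smooth eigen norm v0].
have dv : derivable v 0 1 by exact: (nbhs_singleton smooth 0%N).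
have A1 := laplacian_ones rA.
pose L := A - d%:R%:M; pose v' := derive1 v 0.
have L1 : L *m ones R n.+2 = 0.
  by rewrite /L mulmxBl A1 mul_scalar_mx subrr.
have LT : L^T = L by case: rA => AT _ _ _; rewrite /L linearB /= AT tr_scalar_mx.
have [k Lv'] : exists k, L *m v' = k *: ones R n.+2 - star A *m ones R n.+2.
  apply: eigenvector_branch_derivative => //.
  near=> t; have [l _ lP] : exists2 l,
      largest_eigenvalue (perturbed_adjacency A t) l & perturbed_adjacency A t *m v t = l *: v t by near: t.
  by exists l; rewrite -perturbed_adjacency_star.
have v'1 : dot (ones R n.+2) v' = 0 by exact: normalized_branch_derivative norm.
(* Applying [L] to [Lv'] kills the unknown multiple [k] of the ones. *)
have LLv' : L ^+ 2 *m v' = - correction_vector d A.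
  rewrite expr2 -[L * L]/(L *m L) -mulmxA Lv' mulmxBr -scalemxAr L1.
  by rewrite scaler0 sub0r (laplacian_star rA).
(* [L] is symmetric, so [L^2 u = 0] forces [|L u|^2 = u^T L^2 u = 0]. *)
have kerL2 (u : 'cV[R]_n.+2) : L ^+ 2 *m u = 0 -> exists k, u = k *: ones R n.+2.
  move=> L2u; exists (u 0 0); apply: connected_laplacian_kernel rA conA _.
  apply: dot_eq0; rewrite /dot trmx_mul LT -mulmxA (mulmxA L).
  by rewrite -[L *m L]/(L ^+ 2) L2u mulmx0 mxE.
have c1 : (ones R n.+2)^T *m correction_vector d A = 0.
  have oneL : (ones R n.+2)^T *m L = 0.
    by rewrite -[LHS]trmxK trmx_mul trmxK LT L1 trmx0.
  by rewrite -(laplacian_star rA) mulmxA oneL mul0mx.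
have -> : correction_matrix d A *m correction_vector d A = - v'.
  rewrite /correction_matrix mulmxDl -scalemxAl -mulmxA c1 mulmx0 scaler0 add0r.
  rewrite -[correction_vector d A]opprK -LLv' mulmxN pinv_mulK //.
  by rewrite expr2 -[L * L]/(L *m L) -mulmxA L1 mulmx0.
by rewrite /first_order_approx v0 scalerN -scaleNr opprB.
Unshelve. all: by end_near. Qed.
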